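(* Let $n\ge1$. In the ring $W_n(\mathbb Z)$ of 2-typical Witt vectors of length $n$, for every integer $a$ one has $$[a]_n=c_0[1]_n+c_1V[1]_{n-1}+\cdots+c_{n-1}V^{n-1}[1]_1,$$ where $c_0=a$ and $c_i=2^{-i}\left(a^{2^i}-a^{2^{i-1}}\right)$ for $1\le i\le n-1$.
   Context: $W_n(\mathbb Z)$ is the ring of 2-typical Witt vectors of length $n$, with ghost coordinates $w_i(a_0,\dots,a_{n-1})=\sum_{k=0}^{i}2^ka_k^{2^{i-k}}$; $V:W_{m}(\mathbb Z)\to W_{m+1}(\mathbb Z)$, $V(a_0,\dots,a_{m-1})=(0,a_0,\dots,a_{m-1})$, is the Verschiebung and $[a]_m=(a,0,\dots,0)\in W_m(\mathbb Z)$ is the Teichmüller representative. *)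

(* Defs.v *)
From HB Require Import structures.
From mathcomp Require Import all_boot all_order all_algebra zify.

Set Implicit Arguments.
Unset Strict Implicit.
Unset Printing Implicit Defensive.

Import Order.TTheory GRing.Theory Num.Theory.
Local Open Scope ring_scope.

(* W_n(Z) as a set: the vectors (a_0, ..., a_{n-1}).  The alias keeps its     *)
(* ring structure apart from the tuple type.                                  *)
Definition witt (n : nat) : Type := n.-tuple int.

HB.instance Definition _ n := Choice.copy (witt n) (n.-tuple int).

Definition ghost_seq (s : seq int) (i : nat) : int :=
  \sum_(k < i.+1) 2 ^+ k * s`_k ^+ (2 ^ (i - k)).

(* Meaningful for i < n.                                                      *)
Definition ghost n (a : witt n) (i : nat) : int := ghost_seq (tval a) i.

(* The recursive solution of w_i(s) = x_i for i < n.  The division is exact   *)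
(* as soon as 2 ^ i divides x_i - x_{i-1} for 0 < i < n, see unghostK.        *)
Fixpoint unghost_seq (x : nat -> int) (n : nat) : seq int :=
  if n is m.+1 then
    let s := unghost_seq x m in
    rcons s
      ((x m - \sum_(k < m) 2 ^+ k * s`_k ^+ (2 ^ (m - k))) %/ 2 ^+ m)%Z
  else [::].

Lemma size_unghost x n : size (unghost_seq x n) == n.
Proof. by elim: n => //= n; rewrite size_rcons eqSS. Qed.

Definition unghost n (x : nat -> int) : witt n := Tuple (size_unghost x n).

Definition teich n (a : int) : witt n :=
  [tuple (if i == 0%N :> nat then a else 0) | i < n].

Definition witt0 n : witt n := teich n 0.
Definition witt1 n : witt n := teich n 1.

(* The ghost map of a torsion-free ring is injective, so the equations        *)
(*   w_i(a + b) = w_i(a) + w_i(b),  w_i(a * b) = w_i(a) * w_i(b)              *)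
(* that characterize the universal Witt polynomials determine the operations  *)
(* of W_n(Z): see ghostD, ghostM and ghost_inj.                               *)
Definition witt_opp n (a : witt n) : witt n := unghost n (fun i => - ghost a i).
Definition witt_add n (a b : witt n) : witt n :=
  unghost n (fun i => ghost a i + ghost b i).
Definition witt_mul n (a b : witt n) : witt n :=
  unghost n (fun i => ghost a i * ghost b i).

Definition dwork (x : nat -> int) := forall i, (2 ^+ i.+1 %| x i.+1 - x i)%Z.

Lemma dvd_sqr_sub (a b : int) m :
  (2 ^+ m.+1 %| a - b)%Z -> (2 ^+ m.+2 %| a ^+ 2 - b ^+ 2)%Z.
Proof.
move=> h; rewrite subr_sqr exprSr dvdz_mul //.
have h2 : (2 %| a - b)%Z by apply: dvdz_trans h; rewrite exprS dvdz_mulr.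
have -> : a + b = (a - b) + b * 2 by rewrite mulr_natr mulr2n addrA subrK.
by rewrite rpredD // dvdz_mull.
Qed.

Lemma dvd_exp2_sub (a : int) m :
  (2 ^+ m.+1 %| a ^+ (2 ^ m.+1) - a ^+ (2 ^ m))%Z.
Proof.
elim: m => [|m IH].
  have -> : a ^+ (2 ^ 1) - a ^+ (2 ^ 0) = a * (a - 1).
    by rewrite expn1 expn0 expr1 expr2 mulrBr mulr1.
  rewrite dvdzE abszM dvdn2 oddM; lia.
by rewrite [(2 ^ m.+2)%N]expnSr [in X in _ - X]expnSr !exprM; apply: dvd_sqr_sub.
Qed.

Lemma ghost_seqS s i :
  ghost_seq s i.+1 =
  \sum_(k < i.+1) 2 ^+ k * s`_k ^+ (2 ^ (i.+1 - k)) + 2 ^+ i.+1 * s`_i.+1.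
Proof. by rewrite /ghost_seq big_ord_recr /= subnn expr1. Qed.

Lemma dwork_sum s i :
  (2 ^+ i.+1 %| \sum_(k < i.+1) 2 ^+ k * s`_k ^+ (2 ^ (i.+1 - k))
                - ghost_seq s i)%Z.
Proof.
rewrite /ghost_seq -sumrB; apply: rpred_sum => k _.
have le_ki : (k <= i)%N by rewrite -ltnS.
have E : 2 ^+ i.+1 = 2 ^+ k * 2 ^+ (i - k).+1 :> int.
  by rewrite -exprD addnS subnKC.
rewrite -mulrBr E subSn //.
by apply: dvdz_mul => //; apply: dvd_exp2_sub.
Qed.

Lemma dwork_ghost n (a : witt n) : dwork (ghost a).
Proof.
move=> i; rewrite /ghost ghost_seqS addrAC.
by rewrite rpredD ?dwork_sum // dvdz_mulr.
Qed.

Lemma nth_unghost x m n k : (k < m)%N -> (m <= n)%N ->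
  (unghost_seq x n)`_k = (unghost_seq x m)`_k.
Proof.
move=> lt_km; elim: n => [|n IH]; first by rewrite leqn0 => /eqP ->.
rewrite leq_eqVlt => /predU1P[-> //|]; rewrite ltnS => le_mn.
rewrite /= nth_rcons (eqP (size_unghost _ _)) (leq_trans lt_km le_mn).
exact: IH.
Qed.

Lemma eq_ghost_seq s t i : (forall k, (k <= i)%N -> s`_k = t`_k) ->
  ghost_seq s i = ghost_seq t i.
Proof. by move=> h; apply: eq_bigr => k _; rewrite h // -ltnS. Qed.

Lemma unghostK n x i : dwork x -> (i < n)%N -> ghost (unghost n x) i = x i.
Proof.
rewrite /ghost /= => xP lt_in.
rewrite (eq_ghost_seq (t := unghost_seq x i.+1)); last first.
  by move=> k le_ki; apply: nth_unghost.
elim: i {lt_in n} => [|i IH].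
  rewrite /ghost_seq big_ord1 /= big_ord0 subr0 expr0 mul1r divz1.
  by rewrite expr1.
rewrite ghost_seqS.
have -> : \sum_(k < i.+1) 2 ^+ k * (unghost_seq x i.+2)`_k ^+ (2 ^ (i.+1 - k))
        = \sum_(k < i.+1) 2 ^+ k * (unghost_seq x i.+1)`_k ^+ (2 ^ (i.+1 - k)).
  by apply: eq_bigr => k _; rewrite (@nth_unghost x i.+1).
have -> : (unghost_seq x i.+2)`_i.+1 =
  ((x i.+1 - \sum_(k < i.+1) 2 ^+ k *
     (unghost_seq x i.+1)`_k ^+ (2 ^ (i.+1 - k))) %/ 2 ^+ i.+1)%Z.
  rewrite [unghost_seq x i.+2]/= nth_rcons.
  by rewrite (eqP (size_unghost x i.+1)) ltnn eqxx.
rewrite mulrC divzK ?subrKC //.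
have := dwork_sum (unghost_seq x i.+1) i; rewrite IH => h.
by rewrite -(subrKA (x i)) rpredD ?xP // -opprB rpredN.
Qed.

Lemma ghost_inj n (a b : witt n) :
  (forall i, (i < n)%N -> ghost a i = ghost b i) -> a = b.
Proof.
move=> h; apply: val_inj; apply: (@eq_from_nth _ 0); rewrite !size_tuple //.
elim/ltn_ind => -[|i] IH lt_in.
  have := h _ lt_in; rewrite /ghost /ghost_seq !big_ord1 /= !expr0 !mul1r.
  by rewrite !expr1.
have := h _ lt_in; rewrite /ghost !ghost_seqS.
have -> : \sum_(k < i.+1) 2 ^+ k * (tval a)`_k ^+ (2 ^ (i.+1 - k))
        = \sum_(k < i.+1) 2 ^+ k * (tval b)`_k ^+ (2 ^ (i.+1 - k)).
  apply: eq_bigr => k _; rewrite IH //.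
  exact: ltn_trans (ltn_ord k) lt_in.
by move=> /addrI /mulfI; apply; rewrite expf_neq0.
Qed.

Lemma ghost_teich n a i : (i < n)%N -> ghost (teich n a) i = a ^+ (2 ^ i).
Proof.
move=> lt_in; rewrite /ghost /ghost_seq.
have E k : (k <= i)%N -> (tval (teich n a))`_k = if k == 0%N then a else 0.
  move=> le_ki; have lt_kn := leq_ltn_trans le_ki lt_in.
  by rewrite -[k]/(val (Ordinal lt_kn)) -tnth_nth tnth_mktuple.
rewrite big_ord_recl /= E // expr0 mul1r subn0 big1 ?addr0 // => k _.
rewrite E /=; last exact: (ltn_ord k).
by rewrite expr0n expn_eq0 /= mulr0.
Qed.

Lemma ghost0 n i : (i < n)%N -> ghost (witt0 n) i = 0.
Proof. by move=> h; rewrite ghost_teich // expr0n expn_eq0. Qed.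

Lemma ghost1 n i : (i < n)%N -> ghost (witt1 n) i = 1.
Proof. by move=> h; rewrite ghost_teich // expr1n. Qed.

Lemma ghostN n (a : witt n) i : (i < n)%N -> ghost (witt_opp a) i = - ghost a i.
Proof.
by apply: unghostK => j; rewrite -opprD rpredN; apply: dwork_ghost.
Qed.

Lemma ghostD n (a b : witt n) i :
  (i < n)%N -> ghost (witt_add a b) i = ghost a i + ghost b i.
Proof.
apply: unghostK => j; rewrite opprD addrACA.
by rewrite rpredD //; apply: dwork_ghost.
Qed.

Lemma ghostM n (a b : witt n) i :
  (i < n)%N -> ghost (witt_mul a b) i = ghost a i * ghost b i.
Proof.
apply: unghostK => j.
rewrite -(subrKA (ghost a j * ghost b j.+1)) -mulrBl -mulrBr.
apply: rpredD; first by apply: dvdz_mulr; apply: dwork_ghost.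
by apply: dvdz_mull; apply: dwork_ghost.
Qed.

Section WittRing.
Variable n : nat.
Implicit Types a b c : witt n.

Fact witt_addA : associative (@witt_add n).
Proof. by move=> a b c; apply: ghost_inj => i h; rewrite !ghostD ?addrA. Qed.

Fact witt_addC : commutative (@witt_add n).
Proof. by move=> a b; apply: ghost_inj => i h; rewrite !ghostD // addrC. Qed.

Fact witt_add0 : left_id (witt0 n) (@witt_add n).
Proof. by move=> a; apply: ghost_inj => i h; rewrite ghostD ?ghost0 ?add0r. Qed.

Fact witt_addN : left_inverse (witt0 n) (@witt_opp n) (@witt_add n).
Proof.
by move=> a; apply: ghost_inj => i h; rewrite ghostD ?ghostN ?ghost0 ?addNr.
Qed.

Fact witt_mulA : associative (@witt_mul n).
Proof. by move=> a b c; apply: ghost_inj => i h; rewrite !ghostM ?mulrA. Qed.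

Fact witt_mulC : commutative (@witt_mul n).
Proof. by move=> a b; apply: ghost_inj => i h; rewrite !ghostM // mulrC. Qed.

Fact witt_mul1 : left_id (witt1 n) (@witt_mul n).
Proof. by move=> a; apply: ghost_inj => i h; rewrite ghostM ?ghost1 ?mul1r. Qed.

Fact witt_mulD : left_distributive (@witt_mul n) (@witt_add n).
Proof.
by move=> a b c; apply: ghost_inj => i h; rewrite !(ghostM, ghostD) ?mulrDl.
Qed.

HB.instance Definition _ := GRing.isZmodule.Build (witt n)
  witt_addA witt_addC witt_add0 witt_addN.

HB.instance Definition _ := GRing.Zmodule_isComPzRing.Build (witt n)
  witt_mulA witt_mulC witt_mul1 witt_mulD.

End WittRing.

Definition verschiebung m (a : witt m) : witt m.+1 := [tuple of 0 :: tval a].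

Fixpoint verschiebung_iter (i : nat) m (a : witt m) : witt (i + m) :=
  if i is j.+1 then verschiebung (verschiebung_iter j a) else a.

(* V^i [1]_{n-i}, moved from W_{i + (n-i)}(Z) to W_n(Z) along i + (n-i) = n.  *)
Definition verschiebung_teich1 n (i : 'I_n) : witt n :=
  tcast (subnKC (ltnW (ltn_ord i))) (verschiebung_iter i (teich (n - i) 1)).

(* Main.v *)
(* The ghost map is injective on W_n(Z), and the j-th ghost coordinate of       *)
(* V^i [1] is 2^i for i <= j and 0 otherwise.  So the identity amounts to      *)
(* a^(2^j) = sum_(i <= j) 2^i c_i for every j < n, a telescoping sum; the c_i  *)
(* are integers because a^(2^i) = a^(2^(i-1)) mod 2^i.                         *)
Require Import Defs.
From HB Require Import structures.
From mathcomp Require Import all_boot all_order all_algebra.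

Set Implicit Arguments.
Unset Strict Implicit.
Unset Printing Implicit Defensive.

Import Order.TTheory GRing.Theory Num.Theory.
Local Open Scope ring_scope.

(** By [ghost_inj] it suffices to compare ghost coordinates; being additive, they pass through the
    sum and the integer multiples. [ghost_verschiebung_teich1] cuts the [j]-th one down to the
    indices [i <= j], and [sum_witt_coef] telescopes what remains. *)

Definition ghost_coord n (j : 'I_n) (x : witt n) : int := ghost x j.

(** The type of [j] carries the bound that [ghostD] and [ghostN] require. *)
Fact ghost_coord_is_zmod_morphism n (j : 'I_n) :
  zmod_morphism (ghost_coord j).
Proof.
move=> x y; rewrite /ghost_coord.
by rewrite [LHS](ghostD x (witt_opp y) (ltn_ord j)) ghostN.
Qed.

HB.instance Definition _ n (j : 'I_n) :=
  GRing.isZmodMorphism.Build (witt n) int (ghost_coord j)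
    (@ghost_coord_is_zmod_morphism n j).

(** This is the relation between ghost map and Verschiebung: the shift raises each weight [2 ^+ k]
    by one factor 2 and keeps the exponents. *)
Lemma ghost_seq_cons0 (s : seq int) j :
  ghost_seq (0 :: s) j = if j is j'.+1 then 2 * ghost_seq s j' else 0.
Proof.
rewrite /ghost_seq big_ord_recl /= expr0n expn_eq0 /= mulr0 add0r.
case: j => [|j]; first by rewrite big_ord0.
by rewrite mulr_sumr; apply: eq_bigr => k _; rewrite exprS mulrA.
Qed.

Lemma ghost_verschiebung_iter i m (x : witt m) j :
  ghost (verschiebung_iter i x) j =
    if (i <= j)%N then 2 ^+ i * ghost x (j - i) else 0.
Proof.
elim: i j => [|i IH] j /=; first by rewrite expr0 mul1r subn0.
rewrite {1}/ghost ghost_seq_cons0; case: j => [//|j].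
rewrite [ghost_seq _ j]IH ltnS subSS.
by case: ifP => _; rewrite ?mulr0 // exprS mulrA.
Qed.

Lemma ghost_verschiebung_teich1 n (i : 'I_n) j : (j < n)%N ->
  ghost (verschiebung_teich1 i) j = if (i <= j)%N then 2 ^+ i else 0.
Proof.
move=> lt_jn; rewrite /ghost val_tcast [LHS]ghost_verschiebung_iter.
case: ifP => // le_ij; rewrite ghost_teich ?expr1n ?mulr1 //.
by rewrite ltn_sub2r // (leq_ltn_trans le_ij).
Qed.

(** The division is exact by [dvd_exp2_sub]. *)
Definition witt_coef (a : int) (i : nat) : int :=
  if i is k.+1 then ((a ^+ (2 ^ k.+1) - a ^+ (2 ^ k)) %/ 2 ^+ k.+1)%Z else a.

Lemma witt_coefS a k :
  2 ^+ k.+1 * witt_coef a k.+1 = a ^+ (2 ^ k.+1) - a ^+ (2 ^ k).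
Proof. by rewrite mulrC divzK ?dvd_exp2_sub. Qed.

Lemma sum_witt_coef a j :
  \sum_(i < j.+1) 2 ^+ i * witt_coef a i = a ^+ (2 ^ j).
Proof.
elim: j => [|j IH]; first by rewrite big_ord1 expr0 mul1r expn0 expr1.
by rewrite big_ord_recr /= IH witt_coefS subrKC.
Qed.

Theorem corollary2p4 (n : nat) (hn : (0 < n)%N) (a : int) :
  exists c : nat -> int,
    [/\ c 0%N = a,
        (forall i : nat, (1 <= i <= n - 1)%N ->
           (c i)%:~R = 2 ^- i * (a ^+ (2 ^ i) - a ^+ (2 ^ (i - 1)))%:~R :> rat)
      & teich n a = \sum_(i < n) verschiebung_teich1 i *~ c i].
Proof.
exists (witt_coef a); split=> // [[|k] // _|].
  rewrite subn1 -witt_coefS intrM rmorphXn /= mulKf //.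
  by rewrite expf_neq0.
apply: ghost_inj => j lt_jn; rewrite ghost_teich //.
rewrite -[RHS]/(ghost_coord (Ordinal lt_jn) _) raddf_sum /= -sum_witt_coef.
(* Padding the sum over [i <= j] with zeros up to [n] lets the two sides be matched term by term. *)
rewrite (big_ord_widen n (fun i => 2 ^+ i * witt_coef a i)) // big_mkcond /=.
apply: eq_bigr => i _; rewrite raddfMz /= /ghost_coord.
rewrite ghost_verschiebung_teich1 // ltnS.
by case: ifP => _; rewrite ?mul0rz // mulrzz.
Qed.
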